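(* Let $g>0$, $\nu>0$, $\lambda>0$, $k\ge 0$ be constants, $G=\nu/\lambda$, and let $\zeta\in[0,2]$. Consider the first-order quasilinear system in two space dimensions for the unknowns $H$, $\boldsymbol U=(U,V)$, $\boldsymbol C_h=\boldsymbol C_h^T\in\mathbb R^{2\times2}$, $C_{zz}\in\mathbb R$, obtained from $$\partial_t H+\operatorname{div}(H\boldsymbol U)=0,$$ $$\partial_t(H\boldsymbol U)+\operatorname{div}\big(H\boldsymbol U\otimes\boldsymbol U+H(P+\Sigma_{zz})\boldsymbol I-H\boldsymbol\Sigma_h\big)=-kH\boldsymbol U,\qquad P=gH/2,$$ $$D_t\boldsymbol\Sigma_h-\boldsymbol L_h\boldsymbol\Sigma_h-\boldsymbol\Sigma_h\boldsymbol L_h^T+\zeta(\boldsymbol D_h\boldsymbol\Sigma_h+\boldsymbol\Sigma_h\boldsymbol D_h)=(2\nu\boldsymbol D_h-\boldsymbol\Sigma_h)/\lambda,$$ $$D_t\Sigma_{zz}+2(1-\zeta)(\operatorname{div}\boldsymbol U)\,\Sigma_{zz}=(-2\nu\operatorname{div}\boldsymbol U-\Sigma_{zz})/\lambda$$ by the substitution $\boldsymbol C_h=\lambda\boldsymbol\Sigma_h/\nu+\boldsymbol I$, $C_{zz}=\lambda\Sigma_{zz}/\nu+1$. Then the system is hyperbolic at every state satisfying the constraints $H>0$, $C_{zz}>0$ and $\boldsymbol C_h$ symmetric positive definite if and only if $\zeta=0$ (the upper-convected case); i.e. $\zeta=0$ is the only slip-parameter value for which these constraints ensure hyperbolicity.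
   Context: All fields are functions of $t\ge0$ and $(x,y)\in\mathbb R^2$. $D_t=\partial_t+\boldsymbol U\cdot\nabla=\partial_t+U\partial_x+V\partial_y$; $\boldsymbol L_h=\nabla\boldsymbol U$ is the velocity gradient with entries $(\boldsymbol L_h)_{ij}=\partial_j U_i$; $\boldsymbol D_h=(\boldsymbol L_h+\boldsymbol L_h^T)/2$; $\boldsymbol\Sigma_h$ is a symmetric $2\times2$ matrix field ($\Sigma_{xy}=\Sigma_{yx}$); $\boldsymbol I$ is the $2\times 2$ identity matrix. A quasilinear system $\partial_t Q+A_x(Q)\partial_xQ+A_y(Q)\partial_yQ=S(Q)$ is hyperbolic at a state $Q$ if for every unit vector $(n_x,n_y)$ the matrix $n_xA_x(Q)+n_yA_y(Q)$ is diagonalizable with real eigenvalues. Here $Q=(H,U,V,C_{xx},C_{yy},C_{xy},C_{zz})$. *)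

(* Defs.v *)
From mathcomp Require Import all_boot all_order all_algebra.
From mathcomp Require Import all_classical all_reals all_analysis.
Import Order.TTheory GRing.Theory Num.Theory.
Import numFieldNormedType.Exports.

Set Implicit Arguments.
Unset Strict Implicit.
Unset Printing Implicit Defensive.

Local Open Scope ring_scope.

(* A field of values in T over (t, (x, y)); the point (x, y) is a row vector.
   Fields are total in t, but only points with 0 < t are ever tested. *)
Definition stfield (R : realType) (T : Type) := R -> 'rV[R]_2 -> T.

Section Calculus.
Variable R : realType.

Definition dt (f : stfield R R) : stfield R R :=
  fun t p => derive1 (fun s => f s p) t.

(* j = 0 is the x-derivative, j = 1 the y-derivative. *)
Definition dd (j : 'I_2) (f : stfield R R) : stfield R R :=
  fun t p => 'D_(delta_mx 0 j) (f t) p.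

Definition partially_derivable (f : stfield R R) (t : R) (p : 'rV[R]_2) :=
  derivable (fun s => f s p) t 1 /\
  forall j : 'I_2, derivable (f t) p (delta_mx 0 j).

Definition dt_col n (w : stfield R 'cV[R]_n) : stfield R 'cV[R]_n :=
  fun t p => \col_i dt (fun s q => w s q i 0) t p.

Definition dd_col n (j : 'I_2) (w : stfield R 'cV[R]_n) : stfield R 'cV[R]_n :=
  fun t p => \col_i dd j (fun s q => w s q i 0) t p.

Definition div_vec (w : stfield R 'cV[R]_2) : stfield R R :=
  fun t p => \sum_j dd j (fun s q => w s q j 0) t p.

Definition div_ten (T : stfield R 'M[R]_2) : stfield R 'cV[R]_2 :=
  fun t p => \col_i \sum_j dd j (fun s q => T s q i j) t p.

Definition vgrad (U : stfield R 'cV[R]_2) : stfield R 'M[R]_2 :=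
  fun t p => \matrix_(i, j) dd j (fun s q => U s q i 0) t p.

Definition Dt (U : stfield R 'cV[R]_2) (f : stfield R R) : stfield R R :=
  fun t p => dt f t p + \sum_j U t p j 0 * dd j f t p.

Definition Dt_ten (U : stfield R 'cV[R]_2) (T : stfield R 'M[R]_2) :
    stfield R 'M[R]_2 :=
  fun t p => \matrix_(i, j) Dt U (fun s q => T s q i j) t p.

End Calculus.

Section Model.
Variables (R : realType) (g nu lambda k zeta : R).
Variables (H : stfield R R) (U : stfield R 'cV[R]_2).
Variables (Sh : stfield R 'M[R]_2) (Szz : stfield R R).

Definition mass_eq (t : R) (p : 'rV[R]_2) : Prop :=
  dt H t p + div_vec (fun s q => H s q *: U s q) t p = 0.

Definition pressure : stfield R R := fun t p => g * H t p / 2.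

Definition momentum_flux : stfield R 'M[R]_2 := fun t p =>
  H t p *: (U t p *m (U t p)^T)
  + (H t p * (pressure t p + Szz t p))%:M - H t p *: Sh t p.

Definition momentum_eq (t : R) (p : 'rV[R]_2) : Prop :=
  dt_col (fun s q => H s q *: U s q) t p + div_ten momentum_flux t p
  = - (k * H t p) *: U t p.

Definition stress_h_eq (t : R) (p : 'rV[R]_2) : Prop :=
  let L := vgrad U t p in
  let D := 2^-1 *: (L + L^T) in
  let Sg := Sh t p in
  Dt_ten U Sh t p - L *m Sg - Sg *m L^T + zeta *: (D *m Sg + Sg *m D)
  = lambda^-1 *: ((2 * nu) *: D - Sg).

Definition stress_zz_eq (t : R) (p : 'rV[R]_2) : Prop :=
  Dt U Szz t p + 2 * (1 - zeta) * div_vec U t p * Szz t p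
  = (- (2 * nu) * div_vec U t p - Szz t p) / lambda.

Definition model_at (t : R) (p : 'rV[R]_2) : Prop :=
  [/\ mass_eq t p, momentum_eq t p, stress_h_eq t p & stress_zz_eq t p].

(* Q = (H, U, V, Cxx, Cyy, Cxy, Czz). *)
Definition conformation_state : stfield R 'cV[R]_7 := fun t p =>
  let C := (lambda / nu) *: Sh t p + 1%:M in
  let Czz := lambda * Szz t p / nu + 1 in
  \col_(i < 7) [:: H t p; U t p 0 0; U t p 1 0;
                   C 0 0; C 1 1; C 0 1; Czz]`_i.

Definition fields_regular_at (t : R) (p : 'rV[R]_2) : Prop :=
  [/\ partially_derivable H t p,
      forall i, partially_derivable (fun s q => U s q i 0) t p,
      forall i j, partially_derivable (fun s q => Sh s q i j) t p
    & partially_derivable Szz t p].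

End Model.

(* Satisfaction at (t, p) of  dt Q + Ax(Q) dx Q + Ay(Q) dy Q = S(Q). *)
Definition quasilinear_at (R : realType) (n : nat)
    (Ax Ay : 'cV[R]_n -> 'M[R]_n) (S : 'cV[R]_n -> 'cV[R]_n)
    (Q : stfield R 'cV[R]_n) (t : R) (p : 'rV[R]_2) : Prop :=
  dt_col Q t p + Ax (Q t p) *m dd_col 0 Q t p + Ay (Q t p) *m dd_col 1 Q t p
  = S (Q t p).

(* (Ax, Ay, S) is the quasilinear form of the model in the variables Q: the
   substitution turns the balance laws into it, pointwise.  Since the first
   derivatives of the fields at a point are arbitrary, this determines
   Ax, Ay and S at every state with H > 0. *)
Definition is_quasilinear_form (R : realType) (g nu lambda k zeta : R)
    (Ax Ay : 'cV[R]_7 -> 'M[R]_7) (S : 'cV[R]_7 -> 'cV[R]_7) : Prop :=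
  forall (H : stfield R R) (U : stfield R 'cV[R]_2)
         (Sh : stfield R 'M[R]_2) (Szz : stfield R R) (t : R) (p : 'rV[R]_2),
    (forall s q, (Sh s q)^T = Sh s q) ->
    0 < t -> 0 < H t p ->
    fields_regular_at H U Sh Szz t p ->
    (model_at g nu lambda k zeta H U Sh Szz t p <->
     quasilinear_at Ax Ay S (conformation_state nu lambda H U Sh Szz) t p).

(* [diagonalizable] is over R itself, so the eigenvalues are real. *)
Definition hyperbolic_at (R : realType) (n : nat)
    (Ax Ay : 'cV[R]_n -> 'M[R]_n) (q : 'cV[R]_n) : Prop :=
  forall nx ny : R, nx ^+ 2 + ny ^+ 2 = 1 ->
    diagonalizable (nx *: Ax q + ny *: Ay q).

Definition sym_posdef (R : realType) (n : nat) (M : 'M[R]_n) : Prop :=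
  M^T = M /\ forall v : 'cV[R]_n, v != 0 -> 0 < (v^T *m M *m v) 0 0.

Section States.
Variables (R : realType) (q : 'cV[R]_7).

Definition state_H : R := q 0 0.

Definition state_Ch : 'M[R]_2 :=
  \matrix_(i, j) if i != j then q 5 0 else if i == 0 then q 3 0 else q 4 0.

Definition state_Czz : R := q 6 0.

Definition admissible : Prop :=
  [/\ 0 < state_H, 0 < state_Czz & sym_posdef state_Ch].

End States.

(* Main.v *)
(* In the variables Q the matrix of the system in a direction n is
   (U . n) I + B(n), where B(n) = J M + N J^T only couples the velocity with the
   five remaining unknowns.  Hence B(n)^2 acts on the velocity as the 2x2 matrix
   K = M N.  For zeta = 0 and |n| = 1,
     K = (g H + 3 G Czz) n n^T + G (n . Ch n) I,
   whose eigenvalues are positive and distinct, so B(n) is annihilated by a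
   polynomial with simple real roots.  For zeta > 0, n = (1, 0) and Cxy = 0, K is
   diagonal with K22 = G (Cxx - zeta ((Cxx + Cyy) / 2 - 1)), which is negative
   for large Cyy, so B(n) has purely imaginary eigenvalues. *)
Require Import Defs.
From mathcomp Require Import all_boot all_order all_algebra.
From mathcomp Require Import all_classical all_reals all_analysis.
From mathcomp Require Import ring.
Import Order.TTheory GRing.Theory Num.Theory.
Import numFieldNormedType.Exports.
Local Open Scope ring_scope.

Set Implicit Arguments.
Unset Strict Implicit.
Unset Printing Implicit Defensive.

(** * Real diagonalizability: invariance under shifts, and an obstruction *)

Section SpectralCriteria.
Variable R : realType.

(** A scalar matrix stays scalar in every basis, so the convective part (U . n) I can be
    discarded. *)
Lemma diagonalizable_shift {n} (u : R) (B : 'M[R]_n) :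
  diagonalizable B -> diagonalizable (u%:M + B).
Proof.
case=> P Pu /(similar_diagLR Pu)[d ->]; exists P => //.
apply/similar_diagPex; exists (const_mx u + d); apply/similarP => //.
have -> : diag_mx (const_mx u + d) = u%:M + diag_mx d.
  by rewrite linearD /= diag_const_mx.
by rewrite mulmxDl mulmxDr conjVmx // scalar_mxC !mulmxA mulmxV // mul1mx.
Qed.

(** In an eigenbasis of [A] the square is diagonal with entries [d 0 i ^+ 2]; any nonzero coordinate
    of [r] there identifies [kappa] with one of these real squares. *)
Lemma diagonalizable_sqr_eigenvalue_ge0 {n} (A : 'M[R]_n) (r : 'rV[R]_n)
    (kappa : R) :
  diagonalizable A -> r != 0 -> r *m A *m A = kappa *: r -> 0 <= kappa.
Proof.
case=> P Pu /(similar_diagLR Pu)[d ->]; rewrite conjVmx // => r0 rAA.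
have: r *m invmx P *m diag_mx d *m diag_mx d = kappa *: (r *m invmx P).
  rewrite -[LHS]mulmx1 -(mulmxV Pu) scalemxAl -rAA !mulmxA.
  by rewrite !(mulmxKV Pu, mulmxK Pu).
have: r *m invmx P != 0.
  by apply: contra_neq r0 => rP0; rewrite -(mulmxKV Pu r) rP0 mul0mx.
move: (r *m invmx P) => w /rV0Pn[i wi0] /matrixP/(_ 0 i).
rewrite !mul_mx_diag !mxE => wE.
suff -> : kappa = d 0 i ^+ 2 by exact: sqr_ge0.
by apply: (mulIf wi0); rewrite -wE; ring.
Qed.

End SpectralCriteria.

(* A matrix [J M + N J^T] is block antidiagonal with respect to the splitting
   of the space into the image of [J] and its complement, so its square acts on
   the image of [J] as [M N]. *)
Section BlockAntidiagonal.
Variables (R : realType) (m n : nat).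
Variables (J : 'M[R]_(n.+1, m)) (M : 'M[R]_(m, n.+1)) (N : 'M[R]_(n.+1, m)).
Hypotheses (JJ : J^T *m J = 1%:M) (MJ : M *m J = 0) (JN : J^T *m N = 0).

Let B : 'M[R]_n.+1 := J *m M + N *m J^T.

Lemma antidiag_mx_sqr : B *m B = J *m (M *m N) *m J^T + N *m M.
Proof.
rewrite mulmxDl !mulmxDr !mulmxA -(mulmxA J M J) MJ mulmx0 mul0mx add0r.
by rewrite -(mulmxA N J^T J) JJ mulmx1 -(mulmxA N J^T N) JN mulmx0 mul0mx addr0.
Qed.

(** On matrices of the form J X M + N X J^T, multiplication by B^2 - kappa amounts to multiplying
    [X] by M N - kappa. Since [B] itself is the case X = 1, odd polynomials in [B] reduce to
    polynomials in the small matrix M N. *)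
Lemma antidiag_mx_mul_sqr_sub (X : 'M[R]_m) (kappa : R) :
  (J *m X *m M + N *m X *m J^T) *m (B *m B - kappa%:M) =
  J *m (X *m (M *m N - kappa%:M)) *m M
    + N *m (X *m (M *m N - kappa%:M)) *m J^T.
Proof.
rewrite mulmxBr antidiag_mx_sqr [X *m (_ - _)]mulmxBr !mul_mx_scalar.
rewrite !(mulmxBr, mulmxBl) -!(scalemxAl, scalemxAr).
rewrite scalerDr opprD [RHS]addrACA; congr (_ + _).
rewrite mulmxDl !mulmxDr !mulmxA.
have -> : J *m X *m M *m J = 0 by rewrite -mulmxA MJ mulmx0.
have -> : N *m X *m J^T *m N = 0 by rewrite -mulmxA JN mulmx0.
have -> : N *m X *m J^T *m J = N *m X by rewrite -mulmxA JJ mulmx1.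
by rewrite !mul0mx add0r addr0.
Qed.

(** The product B (B^2 - kappa1) (B^2 - kappa2) reduces to (M N - kappa1) (M N - kappa2) = 0; the
    leading factor [B] accounts for the kernel. *)
Lemma antidiag_mx_diagonalizable (kappa1 kappa2 : R) :
  0 < kappa1 -> 0 < kappa2 -> kappa1 != kappa2 ->
  (M *m N - kappa1%:M) *m (M *m N - kappa2%:M) = 0 ->
  diagonalizable B.
Proof.
move=> k1 k2 k12 K0; apply/diagonalizableP.
set s1 := Num.sqrt kappa1; set s2 := Num.sqrt kappa2.
have s1_gt0 : 0 < s1 by rewrite sqrtr_gt0.
have s2_gt0 : 0 < s2 by rewrite sqrtr_gt0.
have s12 : s1 != s2.
  by apply: contra_neq k12 => e; rewrite -(sqr_sqrtr (ltW k1)) -/s1 e sqr_sqrtr ?ltW.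
(* The roots of X (X^2 - kappa1) (X^2 - kappa2), pairwise distinct because [s1] and [s2] are
   positive and different. *)
exists [:: 0; s1; - s1; s2; - s2].
  have neqN (x y : R) : 0 < x -> 0 < y -> x != - y.
    by move=> x0 y0; rewrite -addr_eq0 gt_eqF ?addr_gt0.
  rewrite /= !inE !negb_or !(eq_sym 0) !(eq_sym (- s1) s2) !oppr_eq0 eqr_opp.
  by rewrite s12 !neqN // !gt_eqF.
apply: mxminpoly_min.
have -> : \prod_(x <- [:: 0; s1; - s1; s2; - s2]) ('X - x%:P) =
    'X * ('X * 'X - kappa1%:P) * ('X * 'X - kappa2%:P) :> {poly R}.
  rewrite !big_cons big_nil -(sqr_sqrtr (ltW k1)) -(sqr_sqrtr (ltW k2)).
  by rewrite -/s1 -/s2 !polyCN !polyCM polyC0; ring.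
rewrite !(rmorphM, rmorphB) /= !horner_mx_X !horner_mx_C.
have -> : B = J *m 1%:M *m M + N *m 1%:M *m J^T by rewrite !mulmx1.
rewrite -!mulmxE !mulmx1 -/B.
have := antidiag_mx_mul_sqr_sub 1%:M kappa1; rewrite !mulmx1 -/B => ->.
by rewrite antidiag_mx_mul_sqr_sub !mul1mx K0 !(mulmx0, mul0mx) addr0.
Qed.

(** Padding [e] by zeros through J^T turns a left eigenvector of M N into one of B^2, whose
    eigenvalues cannot be negative if [B] is diagonalizable over the reals. *)
Lemma antidiag_mx_not_diagonalizable (kappa : R) (e : 'rV[R]_m) :
  e != 0 -> kappa < 0 -> e *m (M *m N) = kappa *: e -> ~ diagonalizable B.
Proof.
move=> e0 k0 eK dB; suff : 0 <= kappa by rewrite leNgt k0.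
apply: (diagonalizable_sqr_eigenvalue_ge0 dB (r := e *m J^T)).
  by apply: contra_neq e0 => eJ0; rewrite -[e]mulmx1 -JJ mulmxA eJ0 mul0mx.
rewrite -mulmxA antidiag_mx_sqr mulmxDr !mulmxA.
rewrite -(mulmxA e J^T J) JJ mulmx1 -(mulmxA e J^T N) JN mulmx0 mul0mx addr0.
by rewrite -(mulmxA e M N) eK scalemxAl.
Qed.

End BlockAntidiagonal.

(** * Componentwise equations and equations equivalent up to a factor *)

Lemma forall_ord2 (P : 'I_2 -> Prop) : (forall i, P i) <-> P 0 /\ P 1.
Proof.
split=> [//|[P0 P1] [[|[|//]] i2]].
- by rewrite (_ : Ordinal i2 = 0) //; apply: val_inj.
- by rewrite (_ : Ordinal i2 = 1) //; apply: val_inj.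
Qed.

Lemma forall_ord7 (P : 'I_7 -> Prop) : (forall i, P i) <->
  ((P 0 /\ P 1 /\ P 2) /\ P 3 /\ P 4 /\ P 5 /\ P 6).
Proof.
split=> [//|[[P0 [P1 P2]] [P3 [P4 [P5 P6]]]] [i i7]].
do 7!(case: i i7 => [|i] i7;
  first by match goal with H : P ?n |- _ =>
    rewrite (_ : Ordinal i7 = n); [exact: H | exact: val_inj] end).
by [].
Qed.

Lemma sum_ord2 (V : zmodType) (F : 'I_2 -> V) : \sum_i F i = F 0 + F 1.
Proof. by rewrite !big_ord_recl big_ord0 addr0; congr (_ + F _); apply: val_inj. Qed.

Lemma sum_ord7 (V : zmodType) (F : 'I_7 -> V) :
  \sum_i F i = F 0 + F 1 + F 2 + F 3 + F 4 + F 5 + F 6.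
Proof.
rewrite !big_ord_recl big_ord0 addr0 !addrA.
by do 6![congr (_ + F _); last exact: val_inj | congr (_ + _)]; congr F; apply: val_inj.
Qed.

Lemma colP2 (R : nzRingType) (u v : 'cV[R]_2) :
  u = v <-> u 0 0 = v 0 0 /\ u 1 0 = v 1 0.
Proof.
rewrite -(forall_ord2 (fun i => u i 0 = v i 0)).
by split=> [-> //|uv]; apply/colP => i; rewrite uv.
Qed.

Lemma matrixP22 (R : nzRingType) (u v : 'M[R]_2) :
  u = v <-> (u 0 0 = v 0 0 /\ u 0 1 = v 0 1) /\ u 1 0 = v 1 0 /\ u 1 1 = v 1 1.
Proof.
rewrite -(forall_ord2 (fun j => u 0 j = v 0 j)) -(forall_ord2 (fun j => u 1 j = v 1 j)).
rewrite -(forall_ord2 (fun i => forall j, u i j = v i j)).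
by split=> [-> //|uv]; apply/matrixP => i j; rewrite uv.
Qed.

Lemma colP7 (R : nzRingType) (u v : 'cV[R]_7) : u = v <->
 ((u 0 0 = v 0 0 /\ u 1 0 = v 1 0 /\ u 2 0 = v 2 0) /\
   u 3 0 = v 3 0 /\ u 4 0 = v 4 0 /\ u 5 0 = v 5 0 /\ u 6 0 = v 6 0).
Proof.
rewrite -(forall_ord7 (fun i => u i 0 = v i 0)).
by split=> [-> //|uv]; apply/colP.
Qed.

Lemma and_iff_compat (P P' S S' : Prop) :
  P <-> P' -> S <-> S' -> P /\ S <-> P' /\ S'.
Proof. by move=> [? ?] [? ?]; split=> -[? ?]; split; auto. Qed.

Lemma eq_scaled (R : idomainType) (c a b a' b' : R) :
  c != 0 -> a - b = c * (a' - b') -> a = b <-> a' = b'.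
Proof.
move=> c0 e; split=> [ab|ab'].
  by apply/eqP; rewrite -subr_eq0 -(mulrI_eq0 _ (mulfI c0)) -e ab subrr.
by apply/eqP; rewrite -subr_eq0 e ab' subrr mulr0.
Qed.

(** Serves to pass from conservative to convective momentum balance: [z] is the mass residual, [m] a
    velocity component and [c] the depth. *)
Lemma eq_scaled_mod (R : idomainType) (c m z a b a' b' : R) :
  z = 0 -> c != 0 -> a - b = c * (a' - b') + m * z -> a = b <-> a' = b'.
Proof. by move=> ->; rewrite mulr0 addr0; exact: eq_scaled. Qed.

(** * Calculus of first partial derivatives at a point *)

Section PartialDerivatives.
Local Open Scope classical_set_scope.
Variable R : realType.

(** The difference quotient along [v] is constantly [c] away from h = 0. *)
Lemma is_derive_affine (V : normedModType R) (f : V -> R) (a v : V) (c : R) :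
  (forall h : R, f (h *: v + a) = f a + h * c) -> is_derive a v f c.
Proof.
move=> fE.
have lim : (fun h => h^-1 *: ((f \o shift a) (h *: v) - f a)) @ 0^' --> c.
  apply: (cvg_trans _ (@cvg_cst _ c _ (0^') _)).
  apply: near_eq_cvg; near=> h.
  have h0 : h != 0 by near: h; exact: nbhs_dnbhs_neq.
  by rewrite /= fE addrC addKr [_ *: _]mulKf.
by apply: DeriveDef; [apply/cvg_ex; exists c | exact: cvg_lim].
Unshelve. all: end_near. Qed.

(** Existence and values are bundled, so that the sum and product rules compute the partials of
    composite fields without separate differentiability goals. *)
Definition has_partials (f : stfield R R) (t : R) (p : 'rV[R]_2)
    (ft fx fy : R) : Prop :=
  [/\ is_derive t 1 (fun s => f s p) ft,
      is_derive p (delta_mx 0 0) (f t) fx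
    & is_derive p (delta_mx 0 1) (f t) fy].

Section Rules.
Variables (t : R) (p : 'rV[R]_2).

Lemma has_partials_dt f ft fx fy : has_partials f t p ft fx fy -> dt f t p = ft.
Proof. by case=> ? _ _; rewrite /dt derive1E derive_val. Qed.

Lemma has_partials_dx f ft fx fy :
  has_partials f t p ft fx fy -> dd 0 f t p = fx.
Proof. by case=> _ ? _; rewrite /dd derive_val. Qed.

Lemma has_partials_dy f ft fx fy :
  has_partials f t p ft fx fy -> dd 1 f t p = fy.
Proof. by case=> _ _ ?; rewrite /dd derive_val. Qed.

Lemma has_partialsP f : partially_derivable f t p ->
  has_partials f t p (dt f t p) (dd 0 f t p) (dd 1 f t p).
Proof.
case=> ft fd; split; [|exact/derivableP/fd..].
by rewrite /dt derive1E; exact: derivableP.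
Qed.

Lemma has_partials_derivable f ft fx fy :
  has_partials f t p ft fx fy -> partially_derivable f t p.
Proof.
case=> dft dfx dfy; split=> [|j]; first exact: ex_derive.
have [->|->] : j = 0 \/ j = 1.
  by case: j => -[|[|]] // ?; [left|right]; apply: val_inj.
all: exact: ex_derive.
Qed.

Lemma has_partials_eq f ft fx fy ft' fx' fy' :
  has_partials f t p ft fx fy -> ft = ft' -> fx = fx' -> fy = fy' ->
  has_partials f t p ft' fx' fy'.
Proof. by move=> + <- <- <-. Qed.

Lemma has_partials_ext f f' ft fx fy : (forall s q, f s q = f' s q) ->
  has_partials f t p ft fx fy -> has_partials f' t p ft fx fy.
Proof. by move=> ff'; rewrite (_ : f = f') //; apply/funext => s; apply/funext. Qed.

Lemma has_partials_cst (c : R) : has_partials (fun _ _ => c) t p 0 0 0.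
Proof. by split; apply: is_derive_cst. Qed.

Lemma has_partialsD f ft fx fy f' ft' fx' fy' :
  has_partials f t p ft fx fy -> has_partials f' t p ft' fx' fy' ->
  has_partials (fun s q => f s q + f' s q) t p (ft + ft') (fx + fx') (fy + fy').
Proof. by case=> ? ? ? [? ? ?]; split; apply: is_deriveD. Qed.

Lemma has_partialsM f ft fx fy f' ft' fx' fy' :
  has_partials f t p ft fx fy -> has_partials f' t p ft' fx' fy' ->
  has_partials (fun s q => f s q * f' s q) t p
    (f t p * ft' + f' t p * ft) (f t p * fx' + f' t p * fx)
    (f t p * fy' + f' t p * fy).
Proof. by case=> ? ? ? [? ? ?]; split; apply: is_deriveM. Qed.

Lemma has_partialsZ (c : R) f ft fx fy : has_partials f t p ft fx fy ->
  has_partials (fun s q => c * f s q) t p (c * ft) (c * fx) (c * fy).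
Proof.
move=> pf; apply: has_partials_eq (has_partialsM (has_partials_cst c) pf) _ _ _;
  by rewrite mulr0 addr0.
Qed.

Lemma has_partials_affine (q qt qx qy : R) :
  has_partials (fun s r => q + (s - t) * qt + (r 0 0 - p 0 0) * qx
                             + (r 0 1 - p 0 1) * qy) t p qt qx qy.
Proof.
by split; apply: is_derive_affine => h; rewrite ?mxE /= /GRing.scale /=; ring.
Qed.

End Rules.
End PartialDerivatives.

(** * The explicit matrix of the system in a direction n *)

Section CharacteristicMatrix.
Variables (R : realType) (g G zeta : R).

(** This is the matrix J of the splitting: the velocity occupies slots 1 and 2 of Q, hence the shift
    [j.+1]. *)
Definition velocity_incl : 'M[R]_(7, 2) := \matrix_(i, j) (i == j.+1 :> nat)%:R.

(* With c = Ch n, these are the blocks M and N: how the velocity equations see the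
   other unknowns, and conversely. *)
Definition momentum_coupling (n1 n2 : R) (q : 'cV[R]_7) : 'M[R]_(2, 7) :=
  let c1 := q 3 0 * n1 + q 5 0 * n2 in
  let c2 := q 5 0 * n1 + q 4 0 * n2 in
  let a := g + G * q 6 0 / q 0 0 in
  \matrix_(i, j) (nth [::]
    [:: [:: a * n1 - G / q 0 0 * c1; 0; 0; - G * n1; 0; - G * n2; G * n1];
        [:: a * n2 - G / q 0 0 * c2; 0; 0; 0; - G * n2; - G * n1; G * n2]] i)`_j.

Definition transport_coupling (n1 n2 : R) (q : 'cV[R]_7) : 'M[R]_(7, 2) :=
  let c1 := q 3 0 * n1 + q 5 0 * n2 in
  let c2 := q 5 0 * n1 + q 4 0 * n2 in
  \matrix_(i, j) (nth [::]
    [:: [:: q 0 0 * n1; q 0 0 * n2];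
        [:: 0; 0];
        [:: 0; 0];
        [:: zeta * (c1 + n1 * q 3 0 - 2 * n1) - 2 * c1; zeta * (n1 * q 5 0)];
        [:: zeta * (n2 * q 5 0); zeta * (c2 + n2 * q 4 0 - 2 * n2) - 2 * c2];
        [:: zeta * ((c2 + n1 * q 5 0 + n2 * q 3 0) / 2 - n2) - c2;
            zeta * ((c1 + n1 * q 4 0 + n2 * q 5 0) / 2 - n1) - c1];
        [:: 2 * ((1 - zeta) * q 6 0 + zeta) * n1;
            2 * ((1 - zeta) * q 6 0 + zeta) * n2]] i)`_j.

Definition char_mx (n1 n2 : R) (q : 'cV[R]_7) : 'M[R]_7 :=
  (q 1 0 * n1 + q 2 0 * n2)%:M
  + (velocity_incl *m momentum_coupling n1 n2 q
     + transport_coupling n1 n2 q *m velocity_incl^T).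

Lemma velocity_incl_orthonormal : velocity_incl^T *m velocity_incl = 1%:M.
Proof.
apply/matrixP22; rewrite !mxE !sum_ord7 !mxE /=.
by rewrite ?(mulr0, mulr1, addr0, add0r).
Qed.

Lemma momentum_coupling_incl n1 n2 q :
  momentum_coupling n1 n2 q *m velocity_incl = 0.
Proof.
apply/matrixP22; rewrite !mxE !sum_ord7 !mxE /=.
by rewrite ?(mulr0, mulr1, addr0, add0r).
Qed.

Lemma incl_transport_coupling n1 n2 q :
  velocity_incl^T *m transport_coupling n1 n2 q = 0.
Proof.
apply/matrixP22; rewrite !mxE !sum_ord7 !mxE /=.
by rewrite ?(mulr0, mul0r, mulr1, addr0, add0r).
Qed.

(** Every block is linear in the direction, so the combinations tested by hyperbolicity are again of
    the form [char_mx]. *)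
Lemma char_mx_linear n1 n2 q : n1 *: char_mx 1 0 q + n2 *: char_mx 0 1 q =
  char_mx n1 n2 q.
Proof.
rewrite /char_mx.
have -> : momentum_coupling n1 n2 q =
    n1 *: momentum_coupling 1 0 q + n2 *: momentum_coupling 0 1 q.
  apply/matrixP => i; apply/forall_ord7; move: i; apply/forall_ord2.
  by rewrite !mxE /=; do !split; ring.
have -> : transport_coupling n1 n2 q =
    n1 *: transport_coupling 1 0 q + n2 *: transport_coupling 0 1 q.
  apply/matrixP => i; apply/forall_ord2; move: i; apply/forall_ord7.
  by rewrite !mxE /=; do !split; field.
rewrite mulmxDr mulmxDl -!scalemxAr -!scalemxAl.
have -> : (q 1 0 * n1 + q 2 0 * n2)%:M =
   n1 *: (q 1 0 * 1 + q 2 0 * 0)%:M + n2 *: (q 1 0 * 0 + q 2 0 * 1)%:M :> 'M[R]_7.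
  by rewrite !scale_scalar_mx -raddfD /=; congr (_%:M); ring.
by rewrite !scalerDr [in LHS]addrACA; congr (_ + _); rewrite addrACA.
Qed.

End CharacteristicMatrix.

(** * The quasilinear system written row by row *)

Section QuasilinearRows.
Variables (R : realType) (g G lambda k zeta : R).

Definition relaxation_source (q : 'cV[R]_7) : 'cV[R]_7 :=
  \col_i [:: 0; - k * q 1 0; - k * q 2 0; (1 - q 3 0) / lambda;
             (1 - q 4 0) / lambda; - q 5 0 / lambda; (1 - q 6 0) / lambda]`_i.

(** Scalar equations ready for comparison with the balance laws. In the rows of Ch no viscous term
    remains: 2 nu D cancels against the identity part of Ch in the upper-convected terms, while the
    slip terms keep Ch - I. *)
Lemma quasilinear_rows (q wt wx wy : 'cV[R]_7) :
  let D i := wt i 0 + q 1 0 * wx i 0 + q 2 0 * wy i 0 in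
  let div := wx 1 0 + wy 2 0 in
  let shear := wy 1 0 + wx 2 0 in
  wt + char_mx g G zeta 1 0 q *m wx + char_mx g G zeta 0 1 q *m wy
    = relaxation_source q <->
  (D 0 + q 0 0 * div = 0 /\
   D 1 + (g + G * (q 6 0 - q 3 0) / q 0 0) * wx 0 0
     - G * q 5 0 / q 0 0 * wy 0 0 + G * (wx 6 0 - wx 3 0 - wy 5 0)
     = - k * q 1 0 /\
   D 2 + (g + G * (q 6 0 - q 4 0) / q 0 0) * wy 0 0
     - G * q 5 0 / q 0 0 * wx 0 0 + G * (wy 6 0 - wy 4 0 - wx 5 0)
     = - k * q 2 0) /\
  D 3 - 2 * (q 3 0 * wx 1 0 + q 5 0 * wy 1 0)
    + zeta * (2 * (q 3 0 - 1) * wx 1 0 + q 5 0 * shear) = (1 - q 3 0) / lambda /\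
  D 4 - 2 * (q 5 0 * wx 2 0 + q 4 0 * wy 2 0)
    + zeta * (2 * (q 4 0 - 1) * wy 2 0 + q 5 0 * shear) = (1 - q 4 0) / lambda /\
  D 5 - (q 5 0 * div + q 3 0 * wx 2 0 + q 4 0 * wy 1 0)
    + zeta * (q 5 0 * div + ((q 3 0 + q 4 0) / 2 - 1) * shear)
    = - q 5 0 / lambda /\
  D 6 + 2 * ((1 - zeta) * q 6 0 + zeta) * div = (1 - q 6 0) / lambda.
Proof.
move=> D div shear.
have MwE n1 n2 (w : 'cV[R]_7) : momentum_coupling g G n1 n2 q *m w = \col_i
    [:: (g * n1 + G * ((q 6 0 - q 3 0) * n1 - q 5 0 * n2) / q 0 0) * w 0 0
          + G * (n1 * w 6 0 - n1 * w 3 0 - n2 * w 5 0);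
        (g * n2 + G * ((q 6 0 - q 4 0) * n2 - q 5 0 * n1) / q 0 0) * w 0 0
          + G * (n2 * w 6 0 - n2 * w 4 0 - n1 * w 5 0)]`_i.
  by apply/colP2; rewrite !mxE !sum_ord7 !mxE /=; split; ring.
have JwE (w : 'cV[R]_7) : (velocity_incl R)^T *m w = \col_i [:: w 1 0; w 2 0]`_i.
  by apply/colP2; rewrite !mxE !sum_ord7 !mxE /=; split; ring.
(* The row index stays symbolic; the indicators let the momentum coupling enter rows 1 and 2
   only. *)
have mulE n1 n2 (w : 'cV[R]_7) i : (char_mx g G zeta n1 n2 q *m w) i 0 =
    (q 1 0 * n1 + q 2 0 * n2) * w i 0
    + ((i == 1)%:R * (momentum_coupling g G n1 n2 q *m w) 0 0
       + (i == 2)%:R * (momentum_coupling g G n1 n2 q *m w) 1 0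
       + (transport_coupling zeta n1 n2 q i 0 * w 1 0
          + transport_coupling zeta n1 n2 q i 1 * w 2 0)).
  rewrite /char_mx !mulmxDl mul_scalar_mx -!mulmxA JwE MwE.
  by rewrite 5!mxE !sum_ord2 ![velocity_incl _ _ _]mxE !mxE.
rewrite colP7; do ![apply: and_iff_compat]; apply: (@eq_scaled _ 1);
  rewrite ?oner_eq0 // mul1r.
all: rewrite 2!mxE !mulE ?MwE.
all: rewrite !mxE /= ?mul0r; congr (_ + _).
all: by rewrite /D /div /shear; first [ring | field].
Qed.

End QuasilinearRows.

(** * Equivalence of the balance laws with the quasilinear system *)

Section QuasilinearForm.
Variables (R : realType) (g nu lambda k zeta : R).
Hypotheses (nu_neq0 : nu != 0) (lambda_neq0 : lambda != 0).

Section Pointwise.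
Variables (H : stfield R R) (U : stfield R 'cV[R]_2).
Variables (Sh : stfield R 'M[R]_2) (Szz : stfield R R) (t : R) (p : 'rV[R]_2).
Variables Ht Hx Hy Ut Ux Uy Vt Vx Vy xxt xxx xxy xyt xyx xyy yyt yyx yyy
  zzt zzx zzy : R.
Hypotheses (Sh_sym : forall s q, (Sh s q)^T = Sh s q)
  (dH : has_partials H t p Ht Hx Hy)
  (dU : has_partials (fun s q => U s q 0 0) t p Ut Ux Uy)
  (dV : has_partials (fun s q => U s q 1 0) t p Vt Vx Vy)
  (dxx : has_partials (fun s q => Sh s q 0 0) t p xxt xxx xxy)
  (dxy : has_partials (fun s q => Sh s q 0 1) t p xyt xyx xyy)
  (dyy : has_partials (fun s q => Sh s q 1 1) t p yyt yyx yyy)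
  (dzz : has_partials Szz t p zzt zzx zzy)
  (H_neq0 : H t p != 0).

Let ShC s q : Sh s q 1 0 = Sh s q 0 1.
Proof. by rewrite -[in LHS]Sh_sym mxE. Qed.

Let dyx : has_partials (fun s q => Sh s q 1 0) t p xyt xyx xyy.
Proof. by apply: has_partials_ext dxy => s q; rewrite ShC. Qed.

Let dHU : has_partials (fun s q => (H s q *: U s q) 0 0) t p
  (H t p * Ut + U t p 0 0 * Ht) (H t p * Ux + U t p 0 0 * Hx)
  (H t p * Uy + U t p 0 0 * Hy).
Proof. by apply: has_partials_ext (has_partialsM dH dU) => s q; rewrite mxE. Qed.

Let dHV : has_partials (fun s q => (H s q *: U s q) 1 0) t p
  (H t p * Vt + U t p 1 0 * Ht) (H t p * Vx + U t p 1 0 * Hx)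
  (H t p * Vy + U t p 1 0 * Hy).
Proof. by apply: has_partials_ext (has_partialsM dH dV) => s q; rewrite mxE. Qed.

Let Q := conformation_state nu lambda H U Sh Szz.

Let dQ0 : has_partials (fun s q => Q s q 0 0) t p Ht Hx Hy.
Proof. by apply: has_partials_ext dH => s q; rewrite /Q /conformation_state !mxE. Qed.

Let dQ1 : has_partials (fun s q => Q s q 1 0) t p Ut Ux Uy.
Proof. by apply: has_partials_ext dU => s q; rewrite /Q /conformation_state !mxE. Qed.

Let dQ2 : has_partials (fun s q => Q s q 2 0) t p Vt Vx Vy.
Proof. by apply: has_partials_ext dV => s q; rewrite /Q /conformation_state !mxE. Qed.

(** Here [c] is the identity's contribution to the conformation variable: 1 for Cxx, Cyy and Czz, 0
    for Cxy. *)
Let dC f ft fx fy (c : R) : has_partials f t p ft fx fy ->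
  has_partials (fun s q => lambda / nu * f s q + c) t p
    (lambda / nu * ft) (lambda / nu * fx) (lambda / nu * fy).
Proof.
move=> df.
apply: has_partials_eq
  (has_partialsD (has_partialsZ (lambda / nu) df) (has_partials_cst t p c)) _ _ _;
  exact: addr0.
Qed.

Let dQ3 : has_partials (fun s q => Q s q 3 0) t p
  (lambda / nu * xxt) (lambda / nu * xxx) (lambda / nu * xxy).
Proof.
by apply: has_partials_ext (dC 1 dxx) => s q; rewrite /Q /conformation_state !mxE.
Qed.

Let dQ4 : has_partials (fun s q => Q s q 4 0) t p
  (lambda / nu * yyt) (lambda / nu * yyx) (lambda / nu * yyy).
Proof.
by apply: has_partials_ext (dC 1 dyy) => s q; rewrite /Q /conformation_state !mxE.
Qed.

Let dQ5 : has_partials (fun s q => Q s q 5 0) t p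
  (lambda / nu * xyt) (lambda / nu * xyx) (lambda / nu * xyy).
Proof.
by apply: has_partials_ext (dC 0 dxy) => s q; rewrite /Q /conformation_state !mxE.
Qed.

Let dQ6 : has_partials (fun s q => Q s q 6 0) t p
  (lambda / nu * zzt) (lambda / nu * zzx) (lambda / nu * zzy).
Proof.
by apply: has_partials_ext (dC 1 dzz) => s q;
  rewrite /Q /conformation_state !mxE /= mulrAC.
Qed.

Let dtQ : dt_col Q t p =
     \col_i [:: Ht; Ut; Vt; lambda / nu * xxt; lambda / nu * yyt;
               lambda / nu * xyt; lambda / nu * zzt]`_i.
Proof.
apply/colP; apply/forall_ord7; split; [split; [|split] | split; [|split; [|split]]];
  rewrite !mxE.
- exact: has_partials_dt dQ0.
- exact: has_partials_dt dQ1.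
- exact: has_partials_dt dQ2.
- exact: has_partials_dt dQ3.
- exact: has_partials_dt dQ4.
- exact: has_partials_dt dQ5.
- exact: has_partials_dt dQ6.
Qed.

Let dxQ : dd_col 0 Q t p =
     \col_i [:: Hx; Ux; Vx; lambda / nu * xxx; lambda / nu * yyx;
               lambda / nu * xyx; lambda / nu * zzx]`_i.
Proof.
apply/colP; apply/forall_ord7; split; [split; [|split] | split; [|split; [|split]]];
  rewrite !mxE.
- exact: has_partials_dx dQ0.
- exact: has_partials_dx dQ1.
- exact: has_partials_dx dQ2.
- exact: has_partials_dx dQ3.
- exact: has_partials_dx dQ4.
- exact: has_partials_dx dQ5.
- exact: has_partials_dx dQ6.
Qed.

Let dyQ : dd_col 1 Q t p =
     \col_i [:: Hy; Uy; Vy; lambda / nu * xxy; lambda / nu * yyy;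
               lambda / nu * xyy; lambda / nu * zzy]`_i.
Proof.
apply/colP; apply/forall_ord7; split; [split; [|split] | split; [|split; [|split]]];
  rewrite !mxE.
- exact: has_partials_dy dQ0.
- exact: has_partials_dy dQ1.
- exact: has_partials_dy dQ2.
- exact: has_partials_dy dQ3.
- exact: has_partials_dy dQ4.
- exact: has_partials_dy dQ5.
- exact: has_partials_dy dQ6.
Qed.

Let QE : Q t p = \col_i
  [:: H t p; U t p 0 0; U t p 1 0; lambda / nu * Sh t p 0 0 + 1;
      lambda / nu * Sh t p 1 1 + 1; lambda / nu * Sh t p 0 1;
      lambda / nu * Szz t p + 1]`_i.
Proof.
rewrite colP7 /Q /conformation_state.
by do !split; rewrite !mxE /= ?addr0 // mulrAC.
Qed.

(** The arguments of [d] are the derivatives, in one common direction, of H, U_i, U_j, Szz and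
    Sh_ij. The factor 1/2 of the pressure disappears on differentiating g H^2 / 2. *)
Let dflux i j ati axi ayi atj axj ayj ct cx cy :
  has_partials (fun s q => U s q i 0) t p ati axi ayi ->
  has_partials (fun s q => U s q j 0) t p atj axj ayj ->
  has_partials (fun s q => Sh s q i j) t p ct cx cy ->
  let d h a b z c :=
    h * (U t p i 0 * U t p j 0) + H t p * (U t p i 0 * b + U t p j 0 * a)
    + (i == j)%:R * (h * (g * H t p + Szz t p) + H t p * z)
    - (h * Sh t p i j + H t p * c) in
  has_partials (fun s q => momentum_flux g H U Sh Szz s q i j) t p
    (d Ht ati atj zzt ct) (d Hx axi axj zzx cx) (d Hy ayi ayj zzy cy).
Proof.
move=> da db dc d.
have dP := has_partialsM dH (has_partialsD (has_partialsZ (g / 2) dH) dzz).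
have := has_partialsD (has_partialsD (has_partialsM dH (has_partialsM da db))
  (has_partialsZ (i == j)%:R dP)) (has_partialsZ (-1) (has_partialsM dH dc)).
move=> dT; apply: has_partials_eq (has_partials_ext _ dT) _ _ _ => [s q|||].
- by rewrite !mxE big_ord1 !mxE /pressure -mulr_natl; field.
- by rewrite /d; field.
- by rewrite /d; field.
- by rewrite /d; field.
Qed.

(** Mass balance is unchanged. A momentum residual is H times its convective form plus a velocity
    component times the mass residual, and a stress residual is nu / lambda times the matching
    conformation residual. *)
Lemma model_at_quasilinear : model_at g nu lambda k zeta H U Sh Szz t p <->
  quasilinear_at (char_mx g (nu / lambda) zeta 1 0)
    (char_mx g (nu / lambda) zeta 0 1) (relaxation_source lambda k) Q t p.
Proof.
rewrite /quasilinear_at quasilinear_rows dtQ dxQ dyQ QE !mxE /=.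
(* The momentum rows are compared under the mass equation [E0]. *)
have and_iff A B C D E0 E1 E2 E3 E4 E5 E6 : A <-> E0 -> (E0 -> B <-> E1 /\ E2) ->
    C <-> E3 /\ E4 /\ E5 -> D <-> E6 ->
  [/\ A, B, C & D] <-> (E0 /\ E1 /\ E2) /\ E3 /\ E4 /\ E5 /\ E6.
  by move=> *; split=> [[]|]; [tauto | split; tauto].
apply: and_iff => [|e0||].
- rewrite /mass_eq /div_vec sum_ord2.
  rewrite (has_partials_dt dH) (has_partials_dx dHU) (has_partials_dy dHV).
  by apply: (@eq_scaled _ 1); [exact: oner_neq0 | ring].
- rewrite /momentum_eq colP2 !mxE !sum_ord2.
  rewrite (has_partials_dt dHU) (has_partials_dt dHV).
  rewrite (has_partials_dx (dflux dU dU dxx)) (has_partials_dy (dflux dU dV dxy)).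
  rewrite (has_partials_dx (dflux dV dU dyx)) (has_partials_dy (dflux dV dV dyy)).
  rewrite ShC /=; apply: and_iff_compat.
    by apply: (eq_scaled_mod (m := U t p 0 0) e0 H_neq0); field; apply/and3P.
  by apply: (eq_scaled_mod (m := U t p 1 0) e0 H_neq0); field; apply/and3P.
- rewrite /stress_h_eq matrixP22 !mxE !sum_ord2 !mxE /Dt !sum_ord2.
  rewrite (has_partials_dt dxx) (has_partials_dt dxy) (has_partials_dt dyx)
    (has_partials_dt dyy) (has_partials_dx dxx) (has_partials_dx dxy)
    (has_partials_dx dyx) (has_partials_dx dyy) (has_partials_dy dxx)
    (has_partials_dy dxy) (has_partials_dy dyx) (has_partials_dy dyy).
  rewrite (has_partials_dx dU) (has_partials_dx dV) (has_partials_dy dU)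
    (has_partials_dy dV) ShC.
  have G_neq0 : nu / lambda != 0 by rewrite mulf_neq0 ?invr_neq0.
  (* By symmetry of the stress, the xy and yx entries both give the Cxy row. *)
  have and_iff A B B' C E3 E4 E5 : A <-> E3 -> B <-> E5 -> B' <-> E5 -> C <-> E4 ->
      (A /\ B) /\ (B' /\ C) <-> E3 /\ E4 /\ E5 by tauto.
  by apply: and_iff; apply: (eq_scaled G_neq0); field; apply/andP.
- have G_neq0 : nu / lambda != 0 by rewrite mulf_neq0 ?invr_neq0.
  rewrite /stress_zz_eq /Dt /div_vec !sum_ord2.
  rewrite (has_partials_dt dzz) (has_partials_dx dzz) (has_partials_dy dzz).
  rewrite (has_partials_dx dU) (has_partials_dy dV).
  by apply: (eq_scaled G_neq0); field; apply/andP.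
Qed.

End Pointwise.

Lemma char_mx_quasilinear_form : is_quasilinear_form g nu lambda k zeta
  (char_mx g (nu / lambda) zeta 1 0) (char_mx g (nu / lambda) zeta 0 1)
  (relaxation_source lambda k).
Proof.
move=> H U Sh Szz t p Sh_sym _ H_gt0 [rH rU rSh rSzz].
exact: (model_at_quasilinear Sh_sym (has_partialsP rH) (has_partialsP (rU 0))
  (has_partialsP (rU 1)) (has_partialsP (rSh 0 0)) (has_partialsP (rSh 0 1))
  (has_partialsP (rSh 1 1)) (has_partialsP rSzz) (lt0r_neq0 H_gt0)).
Qed.

(** The components of Q are prescribed as affine functions centred at (t, p), and the stresses
    recovered by inverting the substitution, Sigma = (nu / lambda) (C - I). The identification holds
    at all points, so derivatives carry over. *)
Lemma affine_fields_realize (q qt qx qy : 'cV[R]_7) (t : R) (p : 'rV[R]_2) :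
  exists H U Sh Szz, let Q := conformation_state nu lambda H U Sh Szz in
  [/\ forall s r, (Sh s r)^T = Sh s r, fields_regular_at H U Sh Szz t p,
      H t p = q 0 0, Q t p = q
    & [/\ dt_col Q t p = qt, dd_col 0 Q t p = qx & dd_col 1 Q t p = qy]].
Proof.
pose f i : stfield R R := fun s r => q i 0 + (s - t) * qt i 0
  + (r 0 0 - p 0 0) * qx i 0 + (r 0 1 - p 0 1) * qy i 0.
have df i : has_partials (f i) t p (qt i 0) (qx i 0) (qy i 0).
  exact: has_partials_affine.
pose Sh : stfield R 'M[R]_2 := fun s r => (nu / lambda) *:
  ((\matrix_(i, j) if i != j then f 5 s r else if i == 0 then f 3 s r else f 4 s r)
   - 1%:M).
pose Szz : stfield R R := fun s r => nu / lambda * (f 6 s r - 1).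
(* Velocity indices 0 and 1 correspond to slots 1 and 2 of Q. *)
pose U : stfield R 'cV[R]_2 := fun s r => \col_i f (inord i.+1) s r.
have Qf s r i : conformation_state nu lambda (f 0) U Sh Szz s r i 0 = f i s r.
  move: i; apply/forall_ord7; rewrite !mxE /= /Szz.
  do !split => //; try (congr (f _ _ _); apply: val_inj; rewrite /= inordK //);
   by field; rewrite ?nu_neq0 ?lambda_neq0.
have ff i : f i t p = q i 0 by rewrite /f !subrr !mul0r !addr0.
exists (f 0), U, Sh, Szz => Q.
have dQ i : has_partials (fun s r => Q s r i 0) t p (qt i 0) (qx i 0) (qy i 0).
  by apply: has_partials_ext (df i) => s r; rewrite Qf.
split.
- by move=> s r; apply/matrixP22; rewrite !mxE.
- split.
  + exact: has_partials_derivable (df 0).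
  + move=> i; apply: (has_partials_derivable (f := _)).
    by apply: has_partials_ext (df (inord i.+1)) => s r; rewrite mxE.
  + move=> i j.
    set c : 'I_7 := if i != j then 5 else if i == 0 then 3 else 4.
    have dc := has_partialsZ (nu / lambda)
      (has_partialsD (df c) (has_partials_cst t p (- (i == j)%:R))).
    apply: has_partials_derivable (has_partials_ext _ dc) => s r.
    by rewrite /Sh !mxE /c; case: (i != j); case: (i == 0).
  + have dc := has_partialsZ (nu / lambda)
      (has_partialsD (df 6) (has_partials_cst t p (-1))).
    exact: has_partials_derivable (has_partials_ext _ dc).
- by rewrite ff.
- by apply/colP => i; rewrite Qf ff.
split; apply/colP => i; rewrite mxE.
- exact: has_partials_dt (dQ i).
- exact: has_partials_dx (dQ i).
- exact: has_partials_dy (dQ i).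
Qed.

End QuasilinearForm.

(** * Uniqueness of the coefficients, and the two spectral cases *)

Section Hyperbolicity.
Variables (R : realType) (g nu lambda k zeta : R).

(* Affine fields realise every state and every first-order jet there, which
   pins down the coefficient matrices. *)
Lemma quasilinear_form_unique Ax Ay S Ax' Ay' S' (q : 'cV[R]_7) :
  nu != 0 -> lambda != 0 ->
  is_quasilinear_form g nu lambda k zeta Ax Ay S ->
  is_quasilinear_form g nu lambda k zeta Ax' Ay' S' ->
  0 < q 0 0 -> Ax q = Ax' q /\ Ay q = Ay' q.
Proof.
move=> nu0 lambda0 F F' q_gt0.
(* The time derivative is chosen to solve the primed system for the given gradients; the model,
   hence the unprimed system, then holds too. The test point has time 1, which is positive as
   required. *)
have transfer qx qy :
    S' q - Ax' q *m qx - Ay' q *m qy + Ax q *m qx + Ay q *m qy = S q.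
  have [H [U [Sh [Szz]]]] := affine_fields_realize nu0 lambda0 q
    (S' q - Ax' q *m qx - Ay' q *m qy) qx qy 1 0.
  set Q := conformation_state _ _ _ _ _ _ => -[Sh_sym reg Hq Qq [dtQ dxQ dyQ]].
  have H_gt0 : 0 < H 1 0 by rewrite Hq.
  have := F' H U Sh Szz 1 0 Sh_sym ltr01 H_gt0 reg.
  rewrite (F H U Sh Szz 1 0 Sh_sym ltr01 H_gt0 reg) /quasilinear_at -/Q.
  rewrite Qq dtQ dxQ dyQ => -[_]; apply.
  by rewrite addrAC subrK subrK.
(* Zero gradients identify the sources; a gradient with a single unit entry then reads off column
   [j] of each matrix. *)
have SS' : S' q = S q by have := transfer 0 0; rewrite !mulmx0 !subr0 !addr0.
split; apply/matrixP => i j.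
- have := transfer (delta_mx j 0) 0.
  rewrite !mulmx0 subr0 addr0 SS' => /colP/(_ i); rewrite -!colE !mxE.
  by rewrite -addrA -{2}[S q i 0]addr0 => /addrI/eqP; rewrite addrC subr_eq0 => /eqP.
- have := transfer 0 (delta_mx j 0).
  rewrite !mulmx0 subr0 addr0 SS' => /colP/(_ i); rewrite -!colE !mxE.
  by rewrite -addrA -{2}[S q i 0]addr0 => /addrI/eqP; rewrite addrC subr_eq0 => /eqP.
Qed.

Lemma upper_convected_char_mx_diagonalizable (G n1 n2 : R) (q : 'cV[R]_7) :
  0 < g -> 0 < G -> n1 ^+ 2 + n2 ^+ 2 = 1 -> admissible q ->
  diagonalizable (char_mx g G 0 n1 n2 q).
Proof.
move=> g0 G0 n1n2 [H0 Czz0 [_ Cpos]]; apply: diagonalizable_shift.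
(* This is n . Ch n, positive because |n| = 1 excludes n = 0. *)
pose ncn := q 3 0 * n1 ^+ 2 + 2 * q 5 0 * (n1 * n2) + q 4 0 * n2 ^+ 2.
have ncn_gt0 : 0 < ncn.
  pose n : 'cV[R]_2 := \col_i [:: n1; n2]`_i.
  have := Cpos n; rewrite !mxE !sum_ord2 !mxE !sum_ord2 !mxE /=.
  rewrite (_ : _ + _ = ncn); last by rewrite /ncn; ring.
  apply; apply: contra_eq_neq n1n2 => /colP n0.
  have := n0 0; have := n0 1; rewrite !mxE /= => -> ->.
  by rewrite expr0n addr0 eq_sym oner_neq0.
(* The coefficient of n n^T in K, hence the gap between its eigenvalues along and across n. *)
pose alpha := g * q 0 0 + 3 * G * q 6 0.
have alpha_gt0 : 0 < alpha by rewrite addr_gt0 ?mulr_gt0.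
apply: (antidiag_mx_diagonalizable (velocity_incl_orthonormal R)
  (momentum_coupling_incl g G n1 n2 q) (incl_transport_coupling 0 n1 n2 q)
  (kappa1 := alpha + G * ncn) (kappa2 := G * ncn)).
- by rewrite addr_gt0 ?mulr_gt0.
- by rewrite mulr_gt0.
- by rewrite -subr_eq0 addrK lt0r_neq0.
have -> : momentum_coupling g G n1 n2 q *m transport_coupling 0 n1 n2 q =
    \matrix_(i, j) (alpha * (if i == 0 then n1 else n2) * (if j == 0 then n1 else n2)
      + G * ncn *+ (i == j)).
  have H_neq0 : q 0 0 != 0 by exact: lt0r_neq0.
  by apply/matrixP22; rewrite !mxE !sum_ord7 !mxE /= /alpha /ncn; do !split; field.
(* The product (K - kappa1) (K - kappa2) equals alpha^2 (|n|^2 - 1) n n^T. *)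
have n1n2_0 : n1 ^+ 2 + n2 ^+ 2 - 1 = 0 by rewrite n1n2 subrr.
apply/matrixP22; rewrite !mxE !sum_ord2 !mxE /=; do !split.
- by transitivity (alpha ^+ 2 * n1 * n1 * (n1 ^+ 2 + n2 ^+ 2 - 1));
    [ring | rewrite n1n2_0 mulr0].
- by transitivity (alpha ^+ 2 * n1 * n2 * (n1 ^+ 2 + n2 ^+ 2 - 1));
    [ring | rewrite n1n2_0 mulr0].
- by transitivity (alpha ^+ 2 * n1 * n2 * (n1 ^+ 2 + n2 ^+ 2 - 1));
    [ring | rewrite n1n2_0 mulr0].
- by transitivity (alpha ^+ 2 * n2 * n2 * (n1 ^+ 2 + n2 ^+ 2 - 1));
    [ring | rewrite n1n2_0 mulr0].
Qed.

Lemma slip_char_mx_not_diagonalizable (G : R) : 0 < G -> 0 < zeta ->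
  exists2 q : 'cV[R]_7, admissible q & ~ diagonalizable (char_mx g G zeta 1 0 q).
Proof.
move=> G0 z0.
(* With Cxx = 1 and Cyy = [c], K22 = G (1 - zeta (c - 1) / 2) = - G zeta / 2 < 0. *)
pose c := 2 + 2 / zeta.
have c0 : 0 < c by rewrite addr_gt0 ?divr_gt0.
pose q : 'cV[R]_7 := \col_i [:: 1; 0; 0; 1; c; 0; 1]`_i.
exists q.
  split; rewrite /state_H /state_Czz ?mxE //=; split.
    by apply/matrixP22; rewrite !mxE /=.
  move=> v v_neq0; rewrite !mxE !sum_ord2 !mxE !sum_ord2 !mxE /=.
  have -> : (v 0 0 * 1 + v 1 0 * 0) * v 0 0 + (v 0 0 * 0 + v 1 0 * c) * v 1 0 =
      v 0 0 ^+ 2 + c * v 1 0 ^+ 2 by ring.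
  have v0_ge0 := sqr_ge0 (v 0 0).
  have v1_ge0 : 0 <= c * v 1 0 ^+ 2 by rewrite mulr_ge0 ?sqr_ge0 ?ltW.
  rewrite lt0r addr_ge0 // andbT paddr_eq0 // sqrf_eq0 mulf_eq0 sqrf_eq0 (gt_eqF c0) /=.
  apply: contra v_neq0 => /andP[/eqP v00 /eqP v10].
  by apply/eqP/colP2; rewrite !mxE.
(* The chosen state is at rest, so the scalar part vanishes. *)
have -> : char_mx g G zeta 1 0 q = velocity_incl R *m momentum_coupling g G 1 0 q
     + transport_coupling zeta 1 0 q *m (velocity_incl R)^T.
  rewrite /char_mx (_ : q 1 0 * 1 + q 2 0 * 0 = 0) ?raddf0 ?add0r //.
  by rewrite !mxE /= !mul0r addr0.
(* The transverse velocity direction, a left eigenvector of the diagonal matrix K for K22. *)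
have e_neq0 : delta_mx 0 1 != 0 :> 'rV[R]_2.
  by apply/rV0Pn; exists 1; rewrite mxE !eqxx oner_eq0.
apply: (antidiag_mx_not_diagonalizable (velocity_incl_orthonormal R)
  (momentum_coupling_incl g G 1 0 q) (incl_transport_coupling zeta 1 0 q)
  (kappa := - (G * zeta / 2)) e_neq0).
- by rewrite oppr_lt0 !mulr_gt0 ?invr_gt0.
have zeta_neq0 := lt0r_neq0 z0.
rewrite -rowE; apply/rowP; apply/forall_ord2; rewrite !mxE !sum_ord7 !mxE /= /c.
by split; field.
Qed.

End Hyperbolicity.

Theorem proposition2p1 (R : realType) (g nu lambda k zeta : R)
    (g_gt0 : 0 < g) (nu_gt0 : 0 < nu) (lambda_gt0 : 0 < lambda)
    (k_ge0 : 0 <= k) (zeta_bounds : 0 <= zeta <= 2) :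
  (exists (Ax Ay : 'cV[R]_7 -> 'M[R]_7) (S : 'cV[R]_7 -> 'cV[R]_7),
     is_quasilinear_form g nu lambda k zeta Ax Ay S) /\
  (forall (Ax Ay : 'cV[R]_7 -> 'M[R]_7) (S : 'cV[R]_7 -> 'cV[R]_7),
     is_quasilinear_form g nu lambda k zeta Ax Ay S ->
     ((forall q : 'cV[R]_7, admissible q -> hyperbolic_at Ax Ay q) <->
      zeta = 0)).
Proof.
have nu_neq0 := lt0r_neq0 nu_gt0; have lambda_neq0 := lt0r_neq0 lambda_gt0.
have G_gt0 : 0 < nu / lambda by rewrite divr_gt0.
have form := char_mx_quasilinear_form g k zeta nu_neq0 lambda_neq0.
split; first by do 3!eexists; exact: form.
move=> Ax Ay S form'.
(* Admissibility gives H > 0, where uniqueness replaces any quasilinear form by the explicit one. *)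
have AE q : admissible q ->
    Ax q = char_mx g (nu / lambda) zeta 1 0 q /\
    Ay q = char_mx g (nu / lambda) zeta 0 1 q.
  by case=> H_gt0 _ _; exact: (quasilinear_form_unique nu_neq0 lambda_neq0 form' form).
split=> [hyp|zeta0 q adm n1 n2 n1n2].
  apply/eqP; case/andP: zeta_bounds; rewrite le_eqVlt => /orP[/eqP <- //|zeta_gt0 _].
  have [q adm []] := slip_char_mx_not_diagonalizable g G_gt0 zeta_gt0.
  have [<- _] := AE q adm.
  (* The direction (1, 0) alone already refutes hyperbolicity. *)
  have := hyp q adm 1 0; rewrite expr1n expr0n addr0 scale1r scale0r addr0.
  exact.
have [-> ->] := AE q adm; rewrite char_mx_linear zeta0.
exact: upper_convected_char_mx_diagonalizable.
Qed.
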